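(* The set $\Omega_+$ of all pairs $(\alpha,\beta)$ for which there exists a non-negative Vershik-Kerov sequence with VK parameters $(\alpha,\beta,0)$ is given by $$\Omega_+=\Bigl\{(\alpha,\beta):\ \beta\ge0,\ \alpha=(\alpha_i)_{i\in\mathbb N}\text{ with }\alpha_i\in\mathbb R,\ \alpha_1\ge\alpha_2\ge\dots\ge0,\ \sum_{i=1}^\infty\alpha_i\le\beta\Bigr\}.$$
   Context: For $x,y\in\mathbb R$: $x\ll y$ iff either $|x|<|y|$, or $|x|=|y|$ and $x\le y$. Power sums: $p_m(x)=\sum_i x_i^m$. A sequence $(\lambda(n))_n$ with $\lambda(n)\in\mathbb R^n$ having entries decreasing w.r.t. $\ll$ (each entry is $\ll$ the preceding one) is a Vershik-Kerov (VK) sequence if the following (finite) limits exist: $\alpha_i:=\lim_{n}\lambda(n)_i/n$ for all $i\in\mathbb N$, $\beta:=\lim_n p_1(\lambda(n))/n$, $\delta:=\lim_n p_2(\lambda(n))/n^2$. In this case $\sum_i\alpha_i^2\le\delta$, one puts $\gamma:=\delta-\sum_i\alpha_i^2$, and $(\alpha,\beta,\gamma)$ with $\alpha=(\alpha_i)_{i\in\mathbb N}$ are the VK parameters of the sequence. The sequence is called non-negative if $\lambda(n)_i\ge0$ for all $i,n$ (in which case automatically $\gamma=0$). *)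

(* Defs.v *)
From HB Require Import structures.
From mathcomp Require Import all_boot all_order all_algebra.
From mathcomp Require Import all_classical all_reals all_analysis.

Set Implicit Arguments.
Unset Strict Implicit.
Unset Printing Implicit Defensive.

Import Order.TTheory GRing.Theory Num.Theory.
Import numFieldNormedType.Exports.

Local Open Scope classical_set_scope.
Local Open Scope ring_scope.

(* Vershik-Kerov sequences.  Indices are 0-based: [alpha i] stands for
   alpha_(i+1) in 1-based notation, and the i-th entry of lambda(n) is [(lambda n)`_i]; for i >= n
   this is the default value 0, which only concerns finitely many n for each
   fixed i and hence does not affect the limits below. *)

Definition vk_le (R : realType) (x y : R) : bool :=
  (`|x| < `|y|) || ((`|x| == `|y|) && (x <= y)).

Definition power_sum (R : realType) (n : nat) (m : nat) (x : n.-tuple R) : R :=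
  \sum_(i < n) tnth x i ^+ m.

Definition vk_decreasing (R : realType) (n : nat) (x : n.-tuple R) : bool :=
  sorted (fun u v => vk_le v u) x.

Definition scaled_entry (R : realType) (lambda : forall n, n.-tuple R)
    (i : nat) : R^nat := fun n => (lambda n)`_i / n%:R.

Definition scaled_p1 (R : realType) (lambda : forall n, n.-tuple R) : R^nat :=
  fun n => power_sum 1 (lambda n) / n%:R.

Definition scaled_p2 (R : realType) (lambda : forall n, n.-tuple R) : R^nat :=
  fun n => power_sum 2 (lambda n) / n%:R ^+ 2.

Definition VK_sequence (R : realType) (lambda : forall n, n.-tuple R) : Prop :=
  [/\ forall n, vk_decreasing (lambda n),
      forall i, cvgn (scaled_entry lambda i),
      cvgn (scaled_p1 lambda) &
      cvgn (scaled_p2 lambda)].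

(* The equation for gamma is stated in the extended reals, where the sum of
   the nonnegative terms alpha_i ^ 2 always makes sense. *)
Definition VK_parameters (R : realType) (lambda : forall n, n.-tuple R)
    (alpha : nat -> R) (beta gamma : R) : Prop :=
  [/\ forall i, scaled_entry lambda i @ \oo --> alpha i,
      scaled_p1 lambda @ \oo --> beta &
      exists2 delta : R, scaled_p2 lambda @ \oo --> delta &
        gamma%:E = (delta%:E - \sum_(0 <= i <oo) (alpha i ^+ 2)%:E)%E].

Definition VK_nonneg (R : realType) (lambda : forall n, n.-tuple R) : Prop :=
  forall (n : nat) (i : 'I_n), 0 <= tnth (lambda n) i.

Definition Omega_plus (R : realType) : set ((nat -> R) * R) :=
  [set ab | exists lambda : forall n, n.-tuple R,
     [/\ VK_sequence lambda, VK_nonneg lambda &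
         VK_parameters lambda ab.1 ab.2 0]].

Arguments Omega_plus R : clear implicits.

(* Main.v *)
Require Import Defs.
From HB Require Import structures.
From mathcomp Require Import all_boot all_order all_algebra.
From mathcomp Require Import all_classical all_reals all_analysis.
From mathcomp Require Import ring.

Set Implicit Arguments.
Unset Strict Implicit.
Unset Printing Implicit Defensive.

Import Order.TTheory GRing.Theory Num.Theory.
Import numFieldNormedType.Exports.

Local Open Scope classical_set_scope.
Local Open Scope ring_scope.

(** Necessity of the conditions is the passage to the limit in finite
    inequalities ([VK_nonneg_bounds]): the entries of [lambda n] are nonnegative
    and decreasing, and the sum of the first [k] of them is at most
    [power_sum 1 (lambda n)].  The bound on the infinite sum then follows by
    letting [k] grow.

    For sufficiency, write [S n] for the sum of the first [n] terms of [alpha].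
    The naive choice [lambda(n)_i = n * alpha_i] has [p_1 / n] equal to [S n],
    which tends to the sum of [alpha] and may miss mass up to [beta].  The
    missing mass is put back evenly over all [n] coordinates:

      [lambda(n)_i = n * alpha_i + (beta - S n)].

    Adding one constant to every entry preserves the order, and [p_1 / n] becomes
    exactly [beta].  After division by [n], each entry moves only by
    [t n = (beta - S n) / n], which tends to 0; hence the limits [alpha_i] are
    kept.  The second moment changes by [t n * (beta + S n)], which tends to 0
    because [S n] is bounded.  So [delta] is the sum of the [alpha_i ^ 2], that
    is, [gamma = 0] ([spread_VK]). *)

Lemma vk_le_ge0 (R : realType) (x y : R) :
  0 <= x -> 0 <= y -> vk_le x y = (x <= y).
Proof.
by move=> x0 y0; rewrite /vk_le !ger0_norm //; case: ltgtP.
Qed.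

(** * Series with nonnegative terms *)

Lemma is_cvg_series_bounded (R : realType) (a : R^nat) (M : R) :
  (forall i, 0 <= a i) -> (forall n, series a n <= M) -> cvgn (series a).
Proof.
move=> a0 aM; apply: nondecreasing_is_cvgn.
  by apply: nondecreasing_series => i _ _; exact: a0.
by exists M => _ [n _ <-].
Qed.

Lemma nneseries_leP (R : realType) (a : R^nat) (M : R) :
  (forall i, 0 <= a i) ->
  (\sum_(0 <= i <oo) (a i)%:E <= M%:E)%E <-> forall n, series a n <= M.
Proof.
move=> a0; split=> [le_M n|le_M].
  rewrite -lee_fin (le_trans _ le_M)// /series/= -sumEFin.
  by apply: nneseries_lim_ge => i _ _; rewrite lee_fin.
apply: lime_le; first by apply: is_cvg_nneseries => i _ _; rewrite lee_fin.
by apply: nearW => n; rewrite sumEFin lee_fin; exact: le_M.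
Qed.

Lemma eseries_EFin (R : realType) (a : R^nat) : cvgn (series a) ->
  (\sum_(0 <= i <oo) (a i)%:E)%E = (limn (series a))%:E.
Proof.
move=> ca; rewrite -EFin_lim//; congr (limn _).
by apply/funext => n /=; rewrite sumEFin.
Qed.

(** Each term is at most [M], so its square is at most [M] times the term. *)
Lemma series_sqr_le (R : realType) (a : R^nat) (M : R) (n : nat) :
  (forall i, 0 <= a i) -> (forall n, series a n <= M) ->
  series (fun i => a i ^+ 2) n <= M ^+ 2.
Proof.
move=> a0 le_M.
have s0 k : 0 <= series a k by rewrite /series/= sumr_ge0.
have a_le_M i : a i <= M.
  by apply: le_trans (le_M i.+1); rewrite seriesSr lerDr.
rewrite expr2 (@le_trans _ _ (M * series a n)) //.
  by rewrite /series/= mulr_sumr ler_sum// => i _; rewrite expr2 ler_wpM2r.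
by rewrite ler_wpM2l// (le_trans (s0 0%N)).
Qed.

(** * Necessity *)

Lemma VK_nonneg_bounds (R : realType) (lambda : forall n, n.-tuple R)
    (alpha : R^nat) (beta gamma : R) :
  VK_sequence lambda -> VK_nonneg lambda ->
  VK_parameters lambda alpha beta gamma ->
  [/\ forall i, alpha i.+1 <= alpha i, forall i, 0 <= alpha i &
      forall n, series alpha n <= beta].
Proof.
move=> [dec _ _ _] nneg [entry_cvg p1_cvg _].
have ge0 n i : 0 <= (lambda n)`_i.
  have [ltin|leni] := ltnP i n; last by rewrite nth_default ?size_tuple.
  by rewrite -(tnth_nth 0 _ (Ordinal ltin)).
split=> [i|i|k].
- apply: ler_cvg_to (entry_cvg i.+1) (entry_cvg i) _; near=> n.
  rewrite ler_wpM2r ?invr_ge0// -vk_le_ge0//.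
  apply: (elimT (sortedP 0) (dec n)); rewrite size_tuple.
  by near: n; exact: nbhs_infty_gt.
- apply: cvgr_to_ge (entry_cvg i) _; apply: nearW => n.
  by rewrite divr_ge0.
- have sum_cvg :
      \sum_(0 <= i < k) scaled_entry lambda i n @[n --> \oo] --> series alpha k.
    by apply: cvg_big => [|i _]; [exact: add_continuous|exact: entry_cvg].
  apply: ler_cvg_to sum_cvg p1_cvg _; near=> n.
  have lekn : (k <= n)%N by near: n; exact: nbhs_infty_ge.
  rewrite -mulr_suml ler_wpM2r ?invr_ge0// /power_sum.
  under [leRHS]eq_bigr do rewrite expr1 (tnth_nth 0).
  rewrite -(big_mkord xpredT (nth 0 (lambda n))).
  by rewrite [leRHS](big_cat_nat (n := k))//= lerDl sumr_ge0.
Unshelve. all: by end_near. Qed.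

(** * Sufficiency: spreading the missing mass evenly *)

Definition spread (R : realType) (alpha : R^nat) (beta : R) (n : nat) :
    n.-tuple R :=
  [tuple n%:R * alpha i + (beta - series alpha n) | i < n].

(** The common amount by which the scaled entries of [spread alpha beta n]
    exceed the [alpha i]. *)
Definition excess (R : realType) (alpha : R^nat) (beta : R) : R^nat :=
  fun n => (beta - series alpha n) / n%:R.

Lemma tnth_spread (R : realType) (alpha : R^nat) (beta : R) (n : nat)
    (i : 'I_n) :
  tnth (spread alpha beta n) i = n%:R * alpha i + (beta - series alpha n).
Proof. by rewrite tnth_mktuple. Qed.

Lemma nth_spread (R : realType) (alpha : R^nat) (beta : R) (n i : nat) :
  (i < n)%N ->
  (spread alpha beta n)`_i = n%:R * alpha i + (beta - series alpha n).
Proof. by move=> ltin; rewrite (nth_mktuple _ _ (Ordinal ltin)). Qed.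

Lemma scaled_entry_spread (R : realType) (alpha : R^nat) (beta : R)
    (i n : nat) : (i < n)%N ->
  scaled_entry (spread alpha beta) i n = alpha i + excess alpha beta n.
Proof.
move=> ltin; have n_neq0 : n%:R != 0 :> R.
  by rewrite pnatr_eq0 -lt0n (leq_trans _ ltin).
by rewrite /scaled_entry nth_spread// mulrDl mulrAC mulfV ?mul1r.
Qed.

Lemma scaled_p1_spread (R : realType) (alpha : R^nat) (beta : R) (n : nat) :
  (0 < n)%N -> scaled_p1 (spread alpha beta) n = beta.
Proof.
move=> n0; have n_neq0 : n%:R != 0 :> R by rewrite pnatr_eq0 -lt0n.
rewrite /scaled_p1 /power_sum.
under eq_bigr do rewrite expr1 tnth_spread.
have ordE : \sum_(i < n) alpha i = series alpha n by rewrite seriesEord.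
rewrite big_split/= -mulr_sumr ordE sumr_const card_ord -[X in _ + X]mulr_natl.
by rewrite -mulrDr subrKC mulrAC mulfV ?mul1r.
Qed.

(** With [t] the excess and [S] the partial sum, the correction is
    [2 * t * S + n * t ^ 2], and [n * t = beta - S]. *)
Lemma scaled_p2_spread (R : realType) (alpha : R^nat) (beta : R) (n : nat) :
  (0 < n)%N ->
  scaled_p2 (spread alpha beta) n =
    series (fun i => alpha i ^+ 2) n
      + excess alpha beta n * (beta + series alpha n).
Proof.
move=> n0; have n_neq0 : n%:R != 0 :> R by rewrite pnatr_eq0 -lt0n.
rewrite /scaled_p2 /power_sum /excess.
set s := series alpha n; set r := beta - s.
have sqrE i : (n%:R * alpha i + r) ^+ 2 =
    n%:R ^+ 2 * alpha i ^+ 2 + (n%:R * r *+ 2) * alpha i + r ^+ 2 by ring.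
under eq_bigr do rewrite tnth_spread -/s -/r sqrE.
rewrite !big_split/= -2!mulr_sumr sumr_const card_ord.
have ordE (u : R^nat) : \sum_(i < n) u i = series u n by rewrite seriesEord.
rewrite (ordE (fun i => alpha i ^+ 2)) ordE -/s -[r ^+ 2 *+ n]mulr_natl /r.
by field.
Qed.

Lemma excess_cvg0 (R : realType) (alpha : R^nat) (beta : R) :
  (forall i, 0 <= alpha i) -> (forall n, series alpha n <= beta) ->
  excess alpha beta @ \oo --> 0.
Proof.
move=> a0 le_b; rewrite -cvg_shiftS.
apply: (@squeeze_cvgr _ _ _ _ (fun=> 0) (fun n => beta * harmonic n)).
- apply: nearW => n; rewrite /excess /=.
  rewrite divr_ge0 ?subr_ge0//= ler_wpM2r ?invr_ge0// lerBlDr lerDl.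
  by rewrite /series/= sumr_ge0.
- exact: cvg_cst.
- by rewrite -[X in _ --> X](mulr0 beta); apply: cvgMr; exact: cvg_harmonic.
Qed.

Lemma spread_VK (R : realType) (alpha : R^nat) (beta : R) :
  (forall i, alpha i.+1 <= alpha i) -> (forall i, 0 <= alpha i) ->
  (forall n, series alpha n <= beta) ->
  [/\ VK_sequence (spread alpha beta), VK_nonneg (spread alpha beta) &
      VK_parameters (spread alpha beta) alpha beta 0].
Proof.
move=> a_dec a0 le_b.
have excess0 := excess_cvg0 a0 le_b.
have ge0 n i : 0 <= n%:R * alpha i + (beta - series alpha n).
  by rewrite addr_ge0 ?mulr_ge0 ?subr_ge0.
have entry_cvg i : scaled_entry (spread alpha beta) i @ \oo --> alpha i.
  have : alpha i + excess alpha beta n @[n --> \oo] --> alpha i.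
    by rewrite -[X in _ --> X]addr0; apply: cvgD => //; exact: cvg_cst.
  apply: cvg_trans; apply: near_eq_cvg; near=> n.
  by rewrite scaled_entry_spread//; near: n; exact: nbhs_infty_gt.
have p1_cvg : scaled_p1 (spread alpha beta) @ \oo --> beta.
  apply: cvg_near_cst; near=> n.
  by rewrite scaled_p1_spread//; near: n; exact: nbhs_infty_gt.
have sqr_cvg : cvgn (series (fun i => alpha i ^+ 2)).
  exact: is_cvg_series_bounded (fun i => sqr_ge0 (alpha i))
    (fun n => series_sqr_le n a0 le_b).
have alpha_cvg : cvgn (series alpha) by exact: is_cvg_series_bounded a0 le_b.
have p2_cvg : scaled_p2 (spread alpha beta) @ \oo -->
    limn (series (fun i => alpha i ^+ 2)).
  have : series (fun i => alpha i ^+ 2) n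
      + excess alpha beta n * (beta + series alpha n) @[n --> \oo] -->
      limn (series (fun i => alpha i ^+ 2)).
    rewrite -[X in _ --> X]addr0; apply: cvgD => //.
    rewrite -(mul0r (beta + limn (series alpha))); apply: cvgM => //.
    by apply: cvgD => //; exact: cvg_cst.
  apply: cvg_trans; apply: near_eq_cvg; near=> n.
  by rewrite scaled_p2_spread//; near: n; exact: nbhs_infty_gt.
split; last first.
- split=> //; exists (limn (series (fun i => alpha i ^+ 2))) => //.
  by rewrite eseries_EFin// subee.
- by move=> n i; rewrite tnth_spread.
split=> [n|i||]; [|by apply/cvg_ex; eexists; eauto..].
apply/(sortedP 0) => i; rewrite size_tuple => ltin.
rewrite !nth_spread ?(ltnW ltin)// vk_le_ge0 ?ge0//.
by rewrite lerD2r ler_wpM2l.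
Unshelve. all: by end_near. Qed.

Theorem proposition4p5 (R : realType) :
  Omega_plus R =
  [set ab : (nat -> R) * R |
     [/\ 0 <= ab.2,
         forall i, ab.1 i.+1 <= ab.1 i,
         forall i, 0 <= ab.1 i &
         (\sum_(0 <= i <oo) (ab.1 i)%:E <= ab.2%:E)%E]].
Proof.
apply/seteqP; split=> -[alpha beta] /=.
  move=> [lambda [vk nneg params]].
  have [a_dec a0 le_b] := VK_nonneg_bounds vk nneg params.
  split=> //; last exact/nneseries_leP.
  (* nonnegativity of beta is the bound on the empty partial sum *)
  by have := le_b 0%N; rewrite /series/= big_geq.
move=> [_ a_dec a0 /(nneseries_leP _ a0) le_b].
by exists (spread alpha beta); exact: spread_VK.
Qed.
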